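(* Let $Y$ be a real topological vector space, $F\subseteq Y$, $a\in Y$, let $H$ be a proper closed subset of $Y$ and $k\in 0^+H\setminus\{0\}$. (a) If $k\in-0^+H$, then $(P_{F,a,H,k})$ does not have an optimal solution. (b) For each real $\lambda>0$, the problem $(P_{F,a,H,\lambda k})$ has the same feasible vectors $y$ and the same optimal solutions $y$ as $(P_{F,a,H,k})$.
   Context: For $A\subseteq Y$, the recession cone is $0^+A:=\{u\in Y\mid A+\mathbb{R}_+u\subseteq A\}$, where $\mathbb{R}_+=[0,\infty)$. A proper subset of $Y$ is a nonempty subset different from $Y$. For $k\in 0^+H\setminus\{0\}$, $(P_{F,a,H,k})$ is the problem of minimizing $t$ over all pairs $(y,t)\in F\times\mathbb{R}$ with $y\in a-H+tk$ (the feasible solutions). A vector $y$ is feasible if $(y,t)$ is feasible for some $t\in\mathbb{R}$. An optimal solution is a feasible $(y,t)$ with $t\le s$ for every feasible $(z,s)$; then $y$ is called an optimal solution $y$. *)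

(* Defs.v *)
From HB Require Import structures.
From mathcomp Require Import all_boot all_order all_algebra.
From mathcomp Require Import all_classical all_reals all_analysis.

Set Implicit Arguments.
Unset Strict Implicit.
Unset Printing Implicit Defensive.

Import Order.TTheory GRing.Theory Num.Theory.

Local Open Scope classical_set_scope.
Local Open Scope ring_scope.

Definition proper_subset (T : Type) (A : set T) : Prop :=
  A !=set0 /\ A <> setT.

Definition recession_cone (R : realType) (Y : lmodType R) (A : set Y) : set Y :=
  [set u | [set x + t *: u | x in A & t in [set t : R | 0 <= t]] `<=` A].

(* The problem $(P_{F,a,H,k})$ is to minimize $t$ over the pairs
   $(y,t) \in F \times \mathbb{R}$ with $y \in a - H + tk$.  The definitions
   make sense for every [k]; the problem is only considered for
   $k \in 0^+H \setminus \{0\}$. *)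
Definition feasible_solutions (R : realType) (Y : lmodType R)
    (F : set Y) (a : Y) (H : set Y) (k : Y) : set (Y * R) :=
  [set p | F p.1 /\ [set a - h + p.2 *: k | h in H] p.1].

Definition feasible_vectors (R : realType) (Y : lmodType R)
    (F : set Y) (a : Y) (H : set Y) (k : Y) : set Y :=
  [set y | exists t : R, feasible_solutions F a H k (y, t)].

Definition optimal_solutions (R : realType) (Y : lmodType R)
    (F : set Y) (a : Y) (H : set Y) (k : Y) : set (Y * R) :=
  [set p | feasible_solutions F a H k p /\
           forall q, feasible_solutions F a H k q -> p.2 <= q.2].

Definition optimal_vectors (R : realType) (Y : lmodType R)
    (F : set Y) (a : Y) (H : set Y) (k : Y) : set Y :=
  [set y | exists t : R, optimal_solutions F a H k (y, t)].

(* Hence $(P_{F,a,H,\lambda k})$ is again an admissible problem when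
   $\lambda > 0$. *)
Lemma recession_cone_scale (R : realType) (Y : lmodType R) (H : set Y) (k : Y)
    (lambda : R) : 0 < lambda ->
  (recession_cone H `\ 0) k -> (recession_cone H `\ 0) (lambda *: k).
Proof.
move=> l0 [kH /eqP k0]; split=> [_ [x Hx [t t0 <-]]|].
- by rewrite scalerA; apply: kH; exists x => //; exists (t * lambda) => //=;
    rewrite mulr_ge0// ltW.
- by apply/eqP; rewrite scaler_eq0 negb_or gt_eqF.
Qed.

(* Main.v *)
Require Import Defs.
From HB Require Import structures.
From mathcomp Require Import all_boot all_order all_algebra.
From mathcomp Require Import all_classical all_reals all_analysis.

Import Order.TTheory GRing.Theory Num.Theory.

Local Open Scope classical_set_scope.
Local Open Scope ring_scope.

(** For (a), write [k = - u] with [u] in the recession cone of [H]. Lowering [t] can be absorbed by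
    moving the point of [H] along [u], so below any feasible [(y, t)] every [(y, s)] with [s <= t]
    is feasible too, and no minimum exists ([feasible_solutions_shift]). For (b),
    [t *: (lambda *: k) = (t * lambda) *: k], so [(y, t)] to [(y, t * lambda)] is a bijection
    between the feasible solutions of the two problems; it fixes [y] and, as [lambda > 0], preserves
    the order of the values. *)

Lemma feasible_solutionsZ (R : realType) (Y : lmodType R) (F : set Y) (a : Y)
    (H : set Y) (k : Y) (lambda : R) (y : Y) (t : R) :
  feasible_solutions F a H (lambda *: k) (y, t) =
  feasible_solutions F a H k (y, t * lambda).
Proof. by rewrite /feasible_solutions/= scalerA. Qed.

Lemma feasible_vectorsZ (R : realType) (Y : lmodType R) (F : set Y) (a : Y)
    (H : set Y) (k : Y) (lambda : R) : lambda != 0 ->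
  feasible_vectors F a H (lambda *: k) = feasible_vectors F a H k.
Proof.
move=> l0; apply/seteqP; split=> y [t yt].
- by exists (t * lambda); rewrite -feasible_solutionsZ.
- by exists (t / lambda); rewrite feasible_solutionsZ divfK.
Qed.

Lemma optimal_solutionsZ (R : realType) (Y : lmodType R) (F : set Y) (a : Y)
    (H : set Y) (k : Y) (lambda : R) (y : Y) (t : R) : 0 < lambda ->
  optimal_solutions F a H (lambda *: k) (y, t) <->
  optimal_solutions F a H k (y, t * lambda).
Proof.
move=> l0; split=> -[yt tmin]; split.
- by rewrite -feasible_solutionsZ.
(* A competitor [(z, s)] for [k] is pulled back to [(z, s / lambda)], a competitor for
   [lambda *: k]. *)
- move=> [z s] zs /=; rewrite -ler_pdivlMr//; apply: (tmin (z, s / lambda)).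
  by rewrite feasible_solutionsZ divfK ?gt_eqF.
- by rewrite feasible_solutionsZ.
- move=> [z s]; rewrite feasible_solutionsZ => /tmin /=.
  by rewrite ler_pM2r.
Qed.

Lemma optimal_vectorsZ (R : realType) (Y : lmodType R) (F : set Y) (a : Y)
    (H : set Y) (k : Y) (lambda : R) : 0 < lambda ->
  optimal_vectors F a H (lambda *: k) = optimal_vectors F a H k.
Proof.
move=> l0; apply/seteqP; split=> y [t yt].
- by exists (t * lambda); apply/optimal_solutionsZ.
- exists (t / lambda); apply/optimal_solutionsZ => //.
  by rewrite divfK ?gt_eqF.
Qed.

(** The direction is written [- u] to match a member of the negated recession cone; the set
    [a - H - t *: u] can then only grow as [t] decreases. *)
Lemma feasible_solutions_shift (R : realType) (Y : lmodType R) (F : set Y)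
    (a : Y) (H : set Y) (u : Y) (y : Y) (t s : R) :
  recession_cone H u -> s <= t ->
  feasible_solutions F a H (- u) (y, t) -> feasible_solutions F a H (- u) (y, s).
Proof.
move=> uH st [Fy [h Hh /= yE]]; split=> //=.
(* Chosen so that [a - (h + (t - s) *: u) - s *: u = a - h - t *: u]; it stays in [H] because
   [t - s] is nonnegative. *)
exists (h + (t - s) *: u).
  by apply: uH; exists h => //; exists (t - s) => //=; rewrite subr_ge0.
by rewrite -yE !scalerN scalerBl opprD opprB !addrA [LHS]addrAC addrK.
Qed.

Theorem proposition12 (R : realType) (Y : topologicalLmodType R)
    (F : set Y) (a : Y) (H : set Y) (k : Y)
    (H_proper : proper_subset H) (H_closed : closed H)
    (k_rec : (recession_cone H `\ 0) k) :
  ([set - u | u in recession_cone H] k ->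
     ~ (exists p : Y * R, optimal_solutions F a H k p)) /\
  (forall lambda : R, 0 < lambda ->
     feasible_vectors F a H (lambda *: k) = feasible_vectors F a H k /\
     optimal_vectors F a H (lambda *: k) = optimal_vectors F a H k).
Proof.
split=> [[u uH <-] [[y t] [yt tmin]]|lambda l0].
  (* Any value below [t] would do to contradict minimality. *)
  have t1 : t - 1 < t by rewrite gtrBl.
  have /tmin /= : feasible_solutions F a H (- u) (y, t - 1).
    by move: yt; apply: feasible_solutions_shift => //; exact: ltW.
  by rewrite leNgt t1.
by split; [rewrite feasible_vectorsZ ?gt_eqF|exact: optimal_vectorsZ].
Qed.
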